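(* For every $k\ge1$ and all $\bm{I}_1,\bm{I}_2,\bm{I}_3,\bm{J}_1,\bm{J}_2,\bm{J}_3\in\{0,1\}^k$, \[\sum_{\bm{K}_1,\bm{K}_2,\bm{K}_3\in\{0,1\}^k}L_y(\bm{K}_3,\bm{K}_2;\bm{J}_3,\bm{J}_2)\,L_x(\bm{I}_3,\bm{K}_1;\bm{K}_3,\bm{J}_1)\,R_{y/x}(\bm{I}_2,\bm{I}_1;\bm{K}_2,\bm{K}_1)=\sum_{\bm{L}_1,\bm{L}_2,\bm{L}_3\in\{0,1\}^k}R_{y/x}(\bm{L}_2,\bm{L}_1;\bm{J}_2,\bm{J}_1)\,L_x(\bm{L}_3,\bm{I}_1;\bm{J}_3,\bm{L}_1)\,L_y(\bm{I}_3,\bm{I}_2;\bm{L}_3,\bm{L}_2).\]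
   Context: For $\bm{I}\in\{0,1\}^k$ write $|\bm{I}|=\sum_m I_m$ and $\bm{I}_{[i,j]}=\sum_{m=i}^j I_m$ (empty sum $0$). The $L$-weights: $L_x(\bm{I},\bm{J};\bm{K},\bm{L})=x^{|\bm{L}|}\prod_{m:L_m=1}t^{\bm{I}_{[m+1,k]}+\bm{J}_{[m+1,k]}}$ if $\bm{I}+\bm{J}=\bm{K}+\bm{L}$ and there is no $i$ with $I_i=J_i=1$, and $0$ otherwise. The $R$-weights, for a parameter $z$ (here $z=y/x$): $R_z(\bm{I},\bm{J};\bm{K},\bm{L})=\prod_{i=1}^k\left(z t^{-\delta_i}\right)^{K_i}\left(1-z t^{-\delta_i}\right)^{(J_i-I_i+L_i-K_i)/2}$ with $\delta_i=\tfrac12\left(\bm{J}_{[i+1,k]}-\bm{I}_{[i+1,k]}+\bm{L}_{[i+1,k]}-\bm{K}_{[i+1,k]}\right)$, whenever $\bm{I}+\bm{J}=\bm{K}+\bm{L}$ and there is no $i$ with $I_i=K_i=1$ and $J_i=L_i=0$; otherwise $R_z(\bm{I},\bm{J};\bm{K},\bm{L})=0$. *)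

(* Defs.v *)
From mathcomp Require Import all_boot all_order all_algebra.

Set Implicit Arguments.
Unset Strict Implicit.
Unset Printing Implicit Defensive.

Import GRing.Theory.
Local Open Scope ring_scope.

Notation bvec k := {ffun 'I_k -> bool}.

(* Coordinates are numbered from 0: index i : 'I_k is the i+1-st coordinate of
   the text. *)
Definition bsize (k : nat) (I : bvec k) : nat := (\sum_(m < k) I m)%N.

(* I_[i+1,k], the sum of the coordinates strictly after i. *)
Definition btail (k : nat) (I : bvec k) (i : 'I_k) : nat :=
  (\sum_(m < k | i < m) I m)%N.

Definition conserved (k : nat) (I J K L : bvec k) : bool :=
  [forall i, (I i + J i == K i + L i)%N].

Definition Lweight (F : fieldType) (t : F) (k : nat) (x : F)
    (I J K L : bvec k) : F :=
  if conserved I J K L && ~~ [exists i, I i && J i]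
  then x ^+ bsize L * \prod_(m < k | L m) t ^+ (btail I m + btail J m)%N
  else 0.

(* The integer divisions by 2 below are exact when I + J = K + L, since then
   J - I + L - K = 2 (J - K); moreover the exponent Rexp is 0 or 1 wherever
   Rweight does not vanish by definition. *)
Definition Rdelta (k : nat) (I J K L : bvec k) (i : 'I_k) : int :=
  (((btail J i)%:Z - (btail I i)%:Z + (btail L i)%:Z - (btail K i)%:Z)
     %/ 2)%Z.

Definition Rexp (k : nat) (I J K L : bvec k) (i : 'I_k) : int :=
  (((J i : nat)%:Z - (I i : nat)%:Z + (L i : nat)%:Z - (K i : nat)%:Z)
     %/ 2)%Z.

Definition Rweight (F : fieldType) (t : F) (k : nat) (z : F)
    (I J K L : bvec k) : F :=
  if conserved I J K L && ~~ [exists i, [&& I i, K i, ~~ J i & ~~ L i]]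
  then \prod_(i < k)
         ((z * t ^ (- Rdelta I J K L i)) ^+ K i *
          (1 - z * t ^ (- Rdelta I J K L i)) ^ Rexp I J K L i)
  else 0.

(* Main.v *)
Require Import Defs.
From mathcomp Require Import all_boot all_order all_algebra.
From mathcomp Require Import ring zify.

(** The weights are products of vertex weights, one per coordinate, and the
    weight of the first coordinate depends on the others only through their
    sizes.  By conservation the first vertices contribute a rational function of
    [u = x t^(|I3| + |K1|)] and [v = y t^(|I3| + |I2|)] on the left, and of
    [u' = x t^(|J3| + |L1|)] and [v' = y t^(|J3| + |J2|)] on the right; [v] and
    [v'] are constant, while [u] and [u'] vary with the summation indices.  So
    the identity does not pass from [k] to [k + 1] by itself, and one inserts
    [p_n(u, v)], resp. [p_n(u', v')], into the sums for every [n], where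
    [p_n(u, v) = \prod_(j < n) (t^j u - v)].  Adding a coordinate then replaces
    the [n]-th sum by the same combination of the [n]-th and [n+1]-st ones on
    both sides, whence equality for all [n]; [n = 0] is the theorem. *)

Set Implicit Arguments.
Unset Strict Implicit.
Unset Printing Implicit Defensive.

Import GRing.Theory.
Local Open Scope ring_scope.

Local Notation triple T := (T * T * T)%type.

Lemma forallb_andb (T : finType) (P Q : pred T) :
  [forall i, P i && Q i] = [forall i, P i] && [forall i, Q i].
Proof.
apply/forallP/andP => [PQ | [/forallP allP /forallP allQ] i].
  by split; apply/forallP => i; case/andP: (PQ i).
by rewrite allP allQ.
Qed.

Lemma prodr_if0 (R : comPzSemiRingType) (T : finType) (P : pred T)
    (E : T -> R) :
  \prod_i (if P i then E i else 0) = if [forall i, P i] then \prod_i E i else 0.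
Proof.
case: ifPn => [/forallP allP | /forallPn[i /negbTE Pi]].
  by apply: eq_bigr => i _; rewrite allP.
by rewrite (bigD1 i) //= Pi mul0r.
Qed.

Lemma big_triple (R : Type) (idx : R) (op : Monoid.com_law idx)
    (A B C : finType) (E : A * B * C -> R) :
  \big[op/idx]_p E p
  = \big[op/idx]_a \big[op/idx]_b \big[op/idx]_c E (a, b, c).
Proof. by rewrite !pair_bigA; apply: eq_bigr => -[[a b] c]. Qed.

Section FfunCons.
Variable T : Type.
Implicit Types (k : nat) (a : T).

Definition ffcons k a (f : {ffun 'I_k -> T}) : {ffun 'I_k.+1 -> T} :=
  [ffun i => if unlift ord0 i is Some j then f j else a].

Definition ffbehead k (f : {ffun 'I_k.+1 -> T}) : {ffun 'I_k -> T} :=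
  [ffun i => f (lift ord0 i)].

Lemma ffcons0 k a (f : {ffun 'I_k -> T}) : ffcons a f ord0 = a.
Proof. by rewrite ffunE unlift_none. Qed.

Lemma ffconsS k a (f : {ffun 'I_k -> T}) i : ffcons a f (lift ord0 i) = f i.
Proof. by rewrite ffunE liftK. Qed.

Lemma ffconsK k a (f : {ffun 'I_k -> T}) : ffbehead (ffcons a f) = f.
Proof. by apply/ffunP => i; rewrite ffunE ffconsS. Qed.

Lemma ffcons_behead k (f : {ffun 'I_k.+1 -> T}) :
  ffcons (f ord0) (ffbehead f) = f.
Proof.
apply/ffunP => i.
by case: (unliftP ord0 i) => [j|] ->; rewrite ?ffconsS ?ffcons0 ?ffunE.
Qed.

Definition ffcons3 k (a : triple T) (f : triple {ffun 'I_k -> T}) :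
    triple {ffun 'I_k.+1 -> T} :=
  let: (a1, a2, a3) := a in let: (f1, f2, f3) := f in
  (ffcons a1 f1, ffcons a2 f2, ffcons a3 f3).

Definition ffuncons3 k (f : triple {ffun 'I_k.+1 -> T}) :
    triple T * triple {ffun 'I_k -> T} :=
  let: (f1, f2, f3) := f in
  ((f1 ord0, f2 ord0, f3 ord0), (ffbehead f1, ffbehead f2, ffbehead f3)).

Lemma ffcons3K k : cancel (fun p => @ffcons3 k p.1 p.2) (@ffuncons3 k).
Proof. by move=> [[[a1 a2] a3] [[f1 f2] f3]]; rewrite /= !ffcons0 !ffconsK. Qed.

Lemma ffuncons3K k : cancel (@ffuncons3 k) (fun p => ffcons3 p.1 p.2).
Proof. by move=> [[f1 f2] f3]; rewrite /= !ffcons_behead. Qed.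

End FfunCons.

Lemma big_ffcons3 (R : Type) (idx : R) (op : Monoid.com_law idx) (T : finType)
    k (E : triple {ffun 'I_k.+1 -> T} -> R) :
  \big[op/idx]_f E f = \big[op/idx]_f \big[op/idx]_a E (ffcons3 a f).
Proof.
rewrite exchange_big pair_bigA (reindex (fun p => ffcons3 p.1 p.2)) //=.
exact: onW_bij (Bijective (@ffcons3K T k) (@ffuncons3K T k)).
Qed.

Section BitVectors.
Variable k : nat.
Implicit Types (b : bool) (I J K L : bvec k).

Lemma bsize_ffcons b I : bsize (ffcons b I) = (b + bsize I)%N.
Proof.
rewrite /bsize big_ord_recl ffcons0; congr addn.
by apply: eq_bigr => i _; rewrite ffconsS.
Qed.

Lemma btail_ffcons0 b I : btail (ffcons b I) ord0 = bsize I.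
Proof.
rewrite /btail /bsize big_mkcond big_ord_recl /= add0n.
by apply: eq_bigr => i _; rewrite ffconsS.
Qed.

Lemma btail_ffconsS b I i : btail (ffcons b I) (lift ord0 i) = btail I i.
Proof.
rewrite /btail big_mkcond big_ord_recl /= add0n [RHS]big_mkcond.
by apply: eq_bigr => j _; rewrite ffconsS.
Qed.

Lemma conserved_sum I J K L (P : pred 'I_k) : conserved I J K L ->
  (\sum_(m | P m) I m + \sum_(m | P m) J m
   = \sum_(m | P m) K m + \sum_(m | P m) L m)%N.
Proof.
by move/forallP=> IJKL; rewrite -!big_split; apply: eq_bigr => m _; apply/eqP.
Qed.

Lemma conserved_bsize I J K L :
  conserved I J K L -> (bsize I + bsize J = bsize K + bsize L)%N.
Proof. exact: conserved_sum. Qed.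

Lemma conserved_btail I J K L i :
  conserved I J K L -> (btail I i + btail J i = btail K i + btail L i)%N.
Proof. exact: conserved_sum. Qed.

End BitVectors.

Section Tpoch.
Variables (R : comNzRingType) (t : R).

Definition tpoch (n : nat) (u v : R) : R := \prod_(j < n) (t ^+ j * u - v).

Lemma tpoch0 u v : tpoch 0 u v = 1.
Proof. exact: big_ord0. Qed.

Lemma tpochSr n u v : tpoch n.+1 u v = tpoch n u v * (t ^+ n * u - v).
Proof. exact: big_ord_recr. Qed.

Lemma tpochSl n u v : tpoch n.+1 u v = (u - v) * tpoch n (t * u) v.
Proof.
rewrite /tpoch big_ord_recl mul1r; congr (_ * _).
by apply: eq_bigr => j _; rewrite exprSr mulrA.
Qed.

Lemma tpochZ n a u v : tpoch n (a * u) (a * v) = a ^+ n * tpoch n u v.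
Proof.
rewrite /tpoch -[X in a ^+ X]card_ord -prodr_const -big_split /=.
by apply: eq_bigr => j _; ring.
Qed.

End Tpoch.

(* [1 - v / u] is the weight of the R-vertex [0, 1; 0, 1]: on either side it is
   the only R-vertex for which [u] is multiplied by [t] and [v] is not. *)
Lemma tpoch_shift (F : fieldType) (t : F) n u v : u != 0 ->
  (1 - v / u) * tpoch t n (t * u) v = (t ^+ n - v / u) * tpoch t n u v.
Proof.
move=> u_neq0; apply: (mulfI u_neq0).
transitivity (tpoch t n.+1 u v); first by rewrite tpochSl; field.
by rewrite tpochSr; field.
Qed.

Section YangBaxter.
Variables (F : fieldType) (t : F).

Definition Lvertex (w : F) (a b c d : bool) : F :=
  if (a + b == c + d)%N && ~~ (a && b) then w ^+ d else 0.

Definition Rvertex (w : F) (a b c d : bool) : F :=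
  if (a + b == c + d)%N && ~~ [&& a, c, ~~ b & ~~ d]
  then w ^+ c * (1 - w) ^+ (b && ~~ c) else 0.

Lemma LweightE x k (I J K L : bvec k) :
  Lweight t x I J K L
  = \prod_i Lvertex (x * t ^+ (btail I i + btail J i)) (I i) (J i) (K i) (L i).
Proof.
rewrite /Lweight /Lvertex prodr_if0 forallb_andb negb_exists.
case: ifP => // _; rewrite /bsize expr_sum [X in _ * X]big_mkcond -big_split.
by apply: eq_bigr => i _; case: (L i); rewrite /= ?mulr1.
Qed.

Lemma RweightE z k (I J K L : bvec k) :
  Rweight t z I J K L
  = \prod_i Rvertex (z * t ^ ((btail K i)%:Z - (btail J i)%:Z))
      (I i) (J i) (K i) (L i).
Proof.
rewrite /Rweight /Rvertex prodr_if0 forallb_andb negb_exists.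
case: ifP => // /andP[IJKL /forallP admissible]; apply: eq_bigr => i _.
have -> : - Rdelta I J K L i = (btail K i)%:Z - (btail J i)%:Z.
  by have := conserved_btail i IJKL; rewrite /Rdelta; lia.
congr (_ * _); move: (forallP IJKL i) (admissible i); rewrite /Rexp.
by case: (I i) (J i) (K i) (L i) => [] [] [] [].
Qed.

Lemma Lweight_nconserved x k (I J K L : bvec k) :
  ~~ conserved I J K L -> Lweight t x I J K L = 0.
Proof. by rewrite /Lweight => /negbTE ->. Qed.

Lemma Rweight_nconserved z k (I J K L : bvec k) :
  ~~ conserved I J K L -> Rweight t z I J K L = 0.
Proof. by rewrite /Rweight => /negbTE ->. Qed.

Definition spectral k (w : F) (I J : bvec k) : F :=
  w * t ^+ (bsize I + bsize J).

Lemma spectral_ffcons k w a b (I J : bvec k) :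
  spectral w (ffcons a I) (ffcons b J) = t ^+ (a + b) * spectral w I J.
Proof. by rewrite /spectral !bsize_ffcons addnACA exprD mulrCA. Qed.

Lemma spectral_neq0 k w (I J : bvec k) :
  w != 0 -> t != 0 -> spectral w I J != 0.
Proof. by move=> w_neq0 t_neq0; rewrite mulf_neq0 ?expf_neq0. Qed.

Lemma spectral_div k x y (I J K : bvec k) : x != 0 -> t != 0 ->
  spectral y I J / spectral x I K
  = y / x * t ^ ((bsize J)%:Z - (bsize K)%:Z).
Proof.
move=> x_neq0 t_neq0; rewrite /spectral !exprD expfzDr // -exprnN -exprnP.
by field; rewrite x_neq0 !expf_neq0.
Qed.

Section FirstCoordinate.
Variables (k : nat) (a b c d : bool) (I J K L : bvec k).

Lemma Lweight_ffcons_IJ x :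
  Lweight t x (ffcons a I) (ffcons b J) (ffcons c K) (ffcons d L)
  = Lvertex (spectral x I J) a b c d * Lweight t x I J K L.
Proof.
rewrite !LweightE big_ord_recl !ffcons0 !btail_ffcons0; congr (_ * _).
by apply: eq_bigr => i _; rewrite !ffconsS !btail_ffconsS.
Qed.

Lemma Lweight_ffcons_KL x :
  Lweight t x (ffcons a I) (ffcons b J) (ffcons c K) (ffcons d L)
  = Lvertex (spectral x K L) a b c d * Lweight t x I J K L.
Proof.
rewrite Lweight_ffcons_IJ.
have [IJKL|nIJKL] := boolP (conserved I J K L).
  by rewrite /spectral (conserved_bsize IJKL).
by rewrite Lweight_nconserved // !mulr0.
Qed.

Lemma Rweight_ffcons_KJ z :
  Rweight t z (ffcons a I) (ffcons b J) (ffcons c K) (ffcons d L)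
  = Rvertex (z * t ^ ((bsize K)%:Z - (bsize J)%:Z)) a b c d
    * Rweight t z I J K L.
Proof.
rewrite !RweightE big_ord_recl !ffcons0 !btail_ffcons0; congr (_ * _).
by apply: eq_bigr => i _; rewrite !ffconsS !btail_ffconsS.
Qed.

Lemma Rweight_ffcons_IL z :
  Rweight t z (ffcons a I) (ffcons b J) (ffcons c K) (ffcons d L)
  = Rvertex (z * t ^ ((bsize I)%:Z - (bsize L)%:Z)) a b c d
    * Rweight t z I J K L.
Proof.
rewrite Rweight_ffcons_KJ.
have [IJKL|nIJKL] := boolP (conserved I J K L); last first.
  by rewrite Rweight_nconserved // !mulr0.
congr (Rvertex (z * t ^ _) _ _ _ _ * _).
by have := conserved_bsize IJKL; lia.
Qed.

End FirstCoordinate.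

(* Triples are indexed by the three lines; the suffixes 13 and 23 name the pair
   of lines whose crossing carries [Lweight t x], resp. [Lweight t y]. *)
Definition left_vertex (u v v' : F) (i j k : triple bool) : F :=
  let: (i1, i2, i3) := i in let: (j1, j2, j3) := j in
  let: (k1, k2, k3) := k in
  Lvertex v' k3 k2 j3 j2 * Lvertex u i3 k1 k3 j1 * Rvertex (v / u) i2 i1 k2 k1.

Definition right_vertex (u v v' : F) (i j l : triple bool) : F :=
  let: (i1, i2, i3) := i in let: (j1, j2, j3) := j in
  let: (l1, l2, l3) := l in
  Rvertex (v' / u) l2 l1 j2 j1 * Lvertex u l3 i1 j3 l1 * Lvertex v i3 i2 l3 l2.

Definition charge13 (i k : triple bool) : nat :=
  let: (_, _, i3) := i in let: (k1, _, _) := k in (i3 + k1)%N.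

Definition charge23 (i : triple bool) : nat :=
  let: (_, i2, i3) := i in (i3 + i2)%N.

(* [stay_coef] and [raise_coef] are read off from the list of the
   configurations of one coordinate with given boundary; they are the same on
   both sides and do not involve the varying parameter [u]. *)
Definition stay_coef (n : nat) (v v' : F) (i j : triple bool) : F :=
  let: (i1, i2, i3) := i in let: (j1, j2, j3) := j in
  if (i1 + i2 + i3 == j1 + j2 + j3)%N then
    match (i1 + i2 + i3)%N with
    | 0 => 1
    | 1 => if j1 then if i1 then 0 else v else t ^+ n * v' ^+ j2
    | 2 => if i1 && j1 then t ^+ n * v * v' ^+ j2 else 0
    | _ => 0
    end
  else 0.

Definition raise_coef (i j : triple bool) : F :=
  let: (i1, i2, i3) := i in let: (j1, j2, j3) := j in
  [&& i1 + i2 + i3 == 1, j1 + j2 + j3 == 1 & j1]%N%:R.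

Lemma sum_left_vertex n u v v' i j : u != 0 ->
  \sum_k left_vertex u v v' i j k
    * tpoch t n (t ^+ charge13 i k * u) (t ^+ charge23 i * v)
  = stay_coef n v v' i j * tpoch t n u v + raise_coef i j * tpoch t n.+1 u v.
Proof.
move=> u_neq0; have shift := tpoch_shift t n v u_neq0.
rewrite big_triple !big_bool.
case: i j => [[[] []] []] [[[] []] []];
  rewrite /= /Lvertex /Rvertex /= ?(mul0r, mulr0, add0r, addr0) //;
  rewrite ?(mul1r, mulr1, expr0, expr1, expr1n, tpochZ, tpochSr) //;
  by rewrite -?mulrA ?shift; field.
Qed.

Lemma sum_right_vertex n u v v' i j : u != 0 ->
  \sum_l right_vertex u v v' i j l
    * tpoch t n (t ^+ charge13 j l * u) (t ^+ charge23 j * v')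
  = stay_coef n v v' i j * tpoch t n u v' + raise_coef i j * tpoch t n.+1 u v'.
Proof.
move=> u_neq0; have shift := tpoch_shift t n v' u_neq0.
rewrite big_triple !big_bool.
case: i j => [[[] []] []] [[[] []] []];
  rewrite /= /Lvertex /Rvertex /= ?(mul0r, mulr0, add0r, addr0) //;
  rewrite ?(mul1r, mulr1, expr0, expr1, expr1n, tpochZ, tpochSr) //;
  by rewrite ?[_ * u * tpoch t _ _ _]mulrAC ?shift; field.
Qed.

Section Moments.
Variables (x y : F).
Hypotheses (x_neq0 : x != 0) (t_neq0 : t != 0).

Section Weights.
Variable k : nat.
Implicit Types (I J K L : triple (bvec k)).

Definition left_weight I J K : F :=
  let: (I1, I2, I3) := I in let: (J1, J2, J3) := J in
  let: (K1, K2, K3) := K in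
  Lweight t y K3 K2 J3 J2 * Lweight t x I3 K1 K3 J1
    * Rweight t (y / x) I2 I1 K2 K1.

Definition right_weight I J L : F :=
  let: (I1, I2, I3) := I in let: (J1, J2, J3) := J in
  let: (L1, L2, L3) := L in
  Rweight t (y / x) L2 L1 J2 J1 * Lweight t x L3 I1 J3 L1
    * Lweight t y I3 I2 L3 L2.

Definition spectral13 I K : F :=
  let: (_, _, I3) := I in let: (K1, _, _) := K in spectral x I3 K1.

Definition spectral23 I : F := let: (_, I2, I3) := I in spectral y I3 I2.

Lemma spectral13_neq0 I K : spectral13 I K != 0.
Proof. by move: I K => [[I1 I2] I3] [[K1 K2] K3]; apply: spectral_neq0. Qed.

End Weights.

Lemma spectral13_ffcons3 k (I K : triple (bvec k)) a b :
  spectral13 (ffcons3 a I) (ffcons3 b K)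
  = t ^+ charge13 a b * spectral13 I K.
Proof.
move: a b => [[a1 a2] a3] [[b1 b2] b3].
by move: I K => [[I1 I2] I3] [[K1 K2] K3]; apply: spectral_ffcons.
Qed.

Lemma spectral23_ffcons3 k (I : triple (bvec k)) a :
  spectral23 (ffcons3 a I) = t ^+ charge23 a * spectral23 I.
Proof.
by move: a I => [[a1 a2] a3] [[I1 I2] I3]; apply: spectral_ffcons.
Qed.

Lemma left_weight_ffcons3 k (I J K : triple (bvec k)) a b c :
  left_weight (ffcons3 a I) (ffcons3 b J) (ffcons3 c K)
  = left_weight I J K
    * left_vertex (spectral13 I K) (spectral23 I) (spectral23 J) a b c.
Proof.
move: a b c => [[a1 a2] a3] [[b1 b2] b3] [[c1 c2] c3].
move: I J K => [[I1 I2] I3] [[J1 J2] J3] [[K1 K2] K3] /=.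
rewrite Lweight_ffcons_KL Lweight_ffcons_IJ Rweight_ffcons_IL spectral_div //.
by ring.
Qed.

Lemma right_weight_ffcons3 k (I J L : triple (bvec k)) a b c :
  right_weight (ffcons3 a I) (ffcons3 b J) (ffcons3 c L)
  = right_weight I J L
    * right_vertex (spectral13 J L) (spectral23 I) (spectral23 J) a b c.
Proof.
move: a b c => [[a1 a2] a3] [[b1 b2] b3] [[c1 c2] c3].
move: I J L => [[I1 I2] I3] [[J1 J2] J3] [[L1 L2] L3] /=.
rewrite Rweight_ffcons_KJ Lweight_ffcons_KL Lweight_ffcons_IJ spectral_div //.
by ring.
Qed.

Definition left_moment (n : nat) k (I J : triple (bvec k)) : F :=
  \sum_K left_weight I J K * tpoch t n (spectral13 I K) (spectral23 I).

Definition right_moment (n : nat) k (I J : triple (bvec k)) : F :=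
  \sum_L right_weight I J L * tpoch t n (spectral13 J L) (spectral23 J).

Lemma left_moment_ffcons3 n k (I J : triple (bvec k)) a b :
  left_moment n (ffcons3 a I) (ffcons3 b J)
  = stay_coef n (spectral23 I) (spectral23 J) a b * left_moment n I J
    + raise_coef a b * left_moment n.+1 I J.
Proof.
rewrite /left_moment big_ffcons3 !mulr_sumr -big_split.
apply: eq_bigr => K _ /=; rewrite ![_ * (left_weight I J K * _)]mulrCA -mulrDr.
rewrite -sum_left_vertex ?spectral13_neq0 // mulr_sumr.
apply: eq_bigr => c _.
by rewrite left_weight_ffcons3 spectral13_ffcons3 spectral23_ffcons3 mulrA.
Qed.

Lemma right_moment_ffcons3 n k (I J : triple (bvec k)) a b :
  right_moment n (ffcons3 a I) (ffcons3 b J)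
  = stay_coef n (spectral23 I) (spectral23 J) a b * right_moment n I J
    + raise_coef a b * right_moment n.+1 I J.
Proof.
rewrite /right_moment big_ffcons3 !mulr_sumr -big_split.
apply: eq_bigr => L _ /=; rewrite ![_ * (right_weight I J L * _)]mulrCA -mulrDr.
rewrite -sum_right_vertex ?spectral13_neq0 // mulr_sumr.
apply: eq_bigr => c _.
by rewrite right_weight_ffcons3 spectral13_ffcons3 spectral23_ffcons3 mulrA.
Qed.

Lemma left_moment_eq_right n k (I J : triple (bvec k)) :
  left_moment n I J = right_moment n I J.
Proof.
elim: k => [|k IHk] in n I J *; last first.
  rewrite -(ffuncons3K I) -(ffuncons3K J).
  by rewrite left_moment_ffcons3 right_moment_ffcons3 !IHk.
move: I J => [[I1 I2] I3] [[J1 J2] J3].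
apply: eq_bigr => -[[K1 K2] K3] _ /=.
by rewrite !LweightE !RweightE /spectral /bsize !big_ord0.
Qed.

Lemma left_moment0 k (I J : triple (bvec k)) :
  left_moment 0 I J = \sum_K left_weight I J K.
Proof. by apply: eq_bigr => K _; rewrite tpoch0 mulr1. Qed.

Lemma right_moment0 k (I J : triple (bvec k)) :
  right_moment 0 I J = \sum_L right_weight I J L.
Proof. by apply: eq_bigr => L _; rewrite tpoch0 mulr1. Qed.

End Moments.
End YangBaxter.

Theorem theorem4p1 (F : fieldType) (x y t : F) (hx : x != 0) (ht : t != 0)
    (k : nat) (hk : (1 <= k)%N) (I1 I2 I3 J1 J2 J3 : {ffun 'I_k -> bool}) :
  \sum_(K1 : {ffun 'I_k -> bool}) \sum_(K2 : {ffun 'I_k -> bool})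
    \sum_(K3 : {ffun 'I_k -> bool})
      Lweight t y K3 K2 J3 J2 * Lweight t x I3 K1 K3 J1
        * Rweight t (y / x) I2 I1 K2 K1
  = \sum_(L1 : {ffun 'I_k -> bool}) \sum_(L2 : {ffun 'I_k -> bool})
    \sum_(L3 : {ffun 'I_k -> bool})
      Rweight t (y / x) L2 L1 J2 J1 * Lweight t x L3 I1 J3 L1
        * Lweight t y I3 I2 L3 L2.
Proof.
have := left_moment_eq_right y hx ht 0 (I1, I2, I3) (J1, J2, J3).
by rewrite left_moment0 right_moment0 !big_triple.
Qed.
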